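(* Let $A\in\mathbb{R}^{n\times n}$, $B\in\mathbb{R}^{n\times m}$, $C\in\mathbb{R}^{p\times n}$ with $(A,B)$ controllable and $(A,C)$ observable, and consider the linear system $\dot x = Ax+Bu$, $y=Cx$. Let $Q=Q^T\ge 0$ ($n\times n$) and $R=R^T>0$ ($m\times m$) be such that the pair $(A,\sqrt{Q})$ is observable. (Sufficiency) Let $P=P^T>0$ be the unique positive definite solution of the Riccati equation $$-A^TP-PA+PBR^{-1}B^TP=Q .$$ If there exists a matrix $F\in\mathbb{R}^{m\times p}$ such that $$(A+BFC)^TP+P(A+BFC)<0,$$ then the control law $u=Fy$ is a stabilizing static output feedback for the system. (Converse) If the system is static output feedback stabilizable, then there always exist matrices $F\in\mathbb{R}^{m\times p}$ and $P=P^T>0$ satisfying $(A+BFC)^TP+P(A+BFC)<0$.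
   Context: Matrix inequalities $>0,\ \ge 0,\ <0$ denote positive definiteness, positive semidefiniteness and negative definiteness of symmetric matrices; $\sqrt{Q}$ is the symmetric positive semidefinite square root of $Q$. A static output feedback is a control law $u=Fy$ with a constant matrix $F$; it is stabilizing if the closed-loop system $\dot x=(A+BFC)x$ is asymptotically (equivalently, exponentially) stable. The system is static output feedback stabilizable if a stabilizing static output feedback exists. In the converse, $P$ is existentially quantified. *)

(* Defs.v *)
From HB Require Import structures.
From mathcomp Require Import all_boot all_order all_algebra.
From mathcomp Require Import all_classical all_reals all_analysis.

Set Implicit Arguments.
Unset Strict Implicit.
Unset Printing Implicit Defensive.

Import Order.TTheory GRing.Theory Num.Theory.
Import numFieldNormedType.Exports.

Local Open Scope classical_set_scope.
Local Open Scope ring_scope.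

Section SymmetricMatrices.
Context {K : realType} {n : nat}.
Implicit Types M S : 'M[K]_n.

(* The definiteness predicates include symmetry. *)
Definition posdefmx M : Prop :=
  M^T = M /\ forall x : 'cV[K]_n, x != 0 -> 0 < (x^T *m M *m x) 0 0.

Definition possemidefmx M : Prop :=
  M^T = M /\ forall x : 'cV[K]_n, 0 <= (x^T *m M *m x) 0 0.

Definition negdefmx M : Prop :=
  M^T = M /\ forall x : 'cV[K]_n, x != 0 -> (x^T *m M *m x) 0 0 < 0.

(* When M is symmetric positive semidefinite, exactly one S satisfies the
   condition; the default value 0 only matters for other M. *)
Definition sqrtmx M : 'M[K]_n :=
  xget 0 [set S | possemidefmx S /\ S *m S = M].

End SymmetricMatrices.

Section LinearSystems.
Context {K : realType}.

(* x solves x' = v(t, x) on the interval J: x is continuous on J and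
   differentiable in its interior.  For v continuous along x, this also gives
   the one-sided derivatives at the endpoints that belong to J. *)
Definition ode_solution {n : nat} (v : K -> 'cV[K]_n -> 'cV[K]_n)
    (J : interval K) (x : K -> 'cV[K]_n) : Prop :=
  {within [set` J], continuous x} /\
  forall t : K, interior [set` J] t -> is_derive t (1 : K) x (v t (x t)).

(* Every state can be steered to every state in finite time by a continuous
   input. *)
Definition controllable {n m : nat} (A : 'M[K]_n) (B : 'M[K]_(n, m)) : Prop :=
  forall x0 x1 : 'cV[K]_n,
  exists (T : K) (u : K -> 'cV[K]_m) (x : K -> 'cV[K]_n),
    [/\ 0 < T,
        {within `[0, T], continuous u},
        ode_solution (fun t z => A *m z + B *m u t) `[0, T] x,
        x 0 = x0
      & x T = x1].

(* The output y = C x on some bounded time interval determines the initial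
   state of x' = A x. *)
Definition observable {n p : nat} (A : 'M[K]_n) (C : 'M[K]_(p, n)) : Prop :=
  exists2 T : K, 0 < T &
  forall x1 x2 : K -> 'cV[K]_n,
    ode_solution (fun _ z => A *m z) `[0, T] x1 ->
    ode_solution (fun _ z => A *m z) `[0, T] x2 ->
    (forall t : K, 0 <= t <= T -> C *m x1 t = C *m x2 t) ->
    x1 0 = x2 0.

(* Lyapunov stability of the origin together with convergence to the origin of
   every solution of x' = M x on [0, +oo[. *)
Definition asymptotically_stable {n : nat} (M : 'M[K]_n) : Prop :=
  (forall e : K, 0 < e -> exists2 d : K, 0 < d &
     forall x : K -> 'cV[K]_n,
       ode_solution (fun _ z => M *m z) `[0, +oo[ x ->
       `|x 0| < d -> forall t : K, 0 <= t -> `|x t| < e) /\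
  (forall x : K -> 'cV[K]_n,
     ode_solution (fun _ z => M *m z) `[0, +oo[ x ->
     x t @[t --> +oo] --> (0 : 'cV[K]_n)).

(* u = F y is stabilizing for x' = A x + B u, y = C x. *)
Definition stabilizing_output_feedback {n m p : nat} (A : 'M[K]_n)
    (B : 'M[K]_(n, m)) (C : 'M[K]_(p, n)) (F : 'M[K]_(m, p)) : Prop :=
  asymptotically_stable (A + B *m F *m C).

Definition static_output_feedback_stabilizable {n m p : nat} (A : 'M[K]_n)
    (B : 'M[K]_(n, m)) (C : 'M[K]_(p, n)) : Prop :=
  exists F : 'M[K]_(m, p), stabilizing_output_feedback A B C F.

End LinearSystems.

(* Main.v *)
(** Both directions are Lyapunov's theorem for the closed-loop matrix
    M = A + B F C.

    If P > 0 and M^T P + P M < 0, compactness of the unit sphere places x^T P x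
    between two positive multiples of |x|^2 and its derivative along solutions
    below a negative one, so (x^T P x) exp(c t) is nonincreasing for some c > 0.

    Conversely, let M be asymptotically stable.  A power series gives a solution
    of x' = M x from every initial state.  Along two solutions the derivative of
    x^T P y is x^T (M^T P + P M) y, and x^T P y tends to 0.  Hence
    M^T P + P M = 0 forces P = 0, the Lyapunov operator is bijective, and
    M^T P + P M = -1 has a solution P.  It is symmetric by uniqueness, and
    x^T P x >= 0 because it decreases to 0 along solutions. *)

Require Import Defs.
From mathcomp Require Import all_boot all_order all_algebra.
From mathcomp Require Import all_classical all_reals all_analysis.
From mathcomp Require Import ring lra.

Import Order.TTheory GRing.Theory Num.Theory.
Import numFieldNormedType.Exports.

Local Open Scope ring_scope.

(** * The bilinear form of a square matrix *)

Section Bilinear.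
Context {K : realType} {n : nat}.
Implicit Types (P : 'M[K]_n) (x y : 'cV[K]_n).

Definition bilin P x y : K := (x^T *m P *m y) 0 0.

Lemma bilinE P x y : bilin P x y = \sum_j \sum_i x i 0 * P i j * y j 0.
Proof.
rewrite /bilin mxE; apply: eq_bigr => j _; rewrite mxE big_distrl /=.
by apply: eq_bigr => i _; rewrite mxE.
Qed.

Lemma bilin_tr P x y : bilin P^T x y = bilin P y x.
Proof.
rewrite /bilin -[in RHS](trmxK (y^T *m P *m x)) [in RHS]mxE.
by rewrite !trmx_mul trmxK mulmxA.
Qed.

Lemma bilinN P x y : bilin (- P) x y = - bilin P x y.
Proof. by rewrite /bilin mulmxN mulNmx mxE. Qed.

Lemma bilinDr P x y z : bilin P x (y + z) = bilin P x y + bilin P x z.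
Proof. by rewrite /bilin mulmxDr mxE. Qed.

Lemma bilinDl P x y z : bilin P (x + y) z = bilin P x z + bilin P y z.
Proof. by rewrite -!(bilin_tr P z) bilinDr. Qed.

Lemma bilinZr P a x y : bilin P x (a *: y) = a * bilin P x y.
Proof. by rewrite /bilin -scalemxAr mxE. Qed.

Lemma bilinZl P a x y : bilin P (a *: x) y = a * bilin P x y.
Proof. by rewrite -!(bilin_tr P y) bilinZr. Qed.

Lemma bilin0r P x : bilin P x 0 = 0.
Proof. by rewrite /bilin mulmx0 mxE. Qed.

Lemma bilin_delta P i j : bilin P (delta_mx i 0) (delta_mx j 0) = P i j.
Proof. by rewrite /bilin trmx_delta -rowE -colE !mxE. Qed.

Lemma bilin0P P : (forall x y, bilin P x y = 0) -> P = 0.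
Proof. by move=> P0; apply/matrixP => i j; rewrite -bilin_delta P0 mxE. Qed.

Lemma bilin1_gt0 x : x != 0 -> 0 < bilin 1%:M x x.
Proof.
rewrite /bilin mulmx1 mxE => x0.
have sq_ge0 : forall i, true -> 0 <= x^T 0 i * x i 0.
  by move=> i _; rewrite mxE -expr2 sqr_ge0.
rewrite lt0r sumr_ge0 // andbT psumr_eq0 //; apply: contra x0 => /allP x0.
apply/eqP/matrixP => i j; rewrite ord1 [RHS]mxE.
have := x0 i (mem_index_enum i); rewrite /= mxE -expr2 sqrf_eq0.
by move/eqP.
Qed.

(** The norm on matrices is the largest absolute value of an entry. *)
Lemma mx_entry_le_norm m p (A : 'M[K]_(m, p)) i j : `|A i j| <= `|A|.
Proof. by rewrite [leRHS]/Num.norm /= mx_normrE; exact: (le_bigmax _ _ (i, j)). Qed.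

Lemma bilin_le_norm P : exists2 b : K, 0 < b &
  forall x, bilin P x x <= b * `|x| ^+ 2.
Proof.
(* The summand 1 keeps the constant positive when [P] is zero. *)
exists (1 + \sum_j \sum_i `|P i j|) => [|x].
  by rewrite ltr_pwDl// sumr_ge0// => j _; rewrite sumr_ge0.
rewrite mulrDl mul1r ler_wpDl ?sqr_ge0// bilinE mulr_suml ler_sum// => j _.
rewrite mulr_suml ler_sum// => i _; apply: le_trans (ler_norm _) _.
rewrite !normrM mulrAC mulrC ler_wpM2l// expr2.
by rewrite ler_pM// mx_entry_le_norm.
Qed.

Lemma cvg_bilin (T : Type) (F : set_system T) {FF : Filter F} P
    (f g : T -> 'cV[K]_n) x y :
  (f @ F --> x -> g @ F --> y ->
  bilin P (f t) (g t) @[t --> F] --> bilin P x y)%classic.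
Proof.
move=> fx gy.
have entry (h : T -> 'cV[K]_n) (z : 'cV[K]_n) i :
    (h @ F --> z -> (fun t => h t i 0) @ F --> z i 0)%classic.
  by move=> hz; apply: (cvg_comp h (fun M : 'cV[K]_n => M i 0) hz); exact: coord_continuous.
rewrite bilinE; under eq_cvg do rewrite bilinE.
apply: cvg_big => [|j _]; first exact: add_continuous.
apply: cvg_big => [|i _]; first exact: add_continuous.
by apply: cvgM; [apply: cvgM; [|exact: cvg_cst]|]; exact: entry.
Qed.

End Bilinear.

(** * Lower bound for a positive definite form *)

Lemma norm_trmx {K : realType} m p (A : 'M[K]_(m, p)) : `|A^T| = `|A|.
Proof.
have norm_trmx_le q r (B : 'M[K]_(q, r)) : `|B^T| <= `|B|.
  rewrite [leLHS]/Num.norm /= mx_normrE bigmax_le// => -[i j] _.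
  by rewrite mxE mx_entry_le_norm.
by apply/eqP; rewrite eq_le norm_trmx_le -{1}[A]trmxK norm_trmx_le.
Qed.

(** The constant is the minimum of the form on the unit sphere; homogeneity of degree 2 extends the
    bound to all vectors. The sphere [S] consists of row vectors, to which [bounded_closed_compact]
    applies. *)
Lemma bilin_ge_norm {K : realType} {n : nat} (P : 'M[K]_n) :
  (forall x : 'cV[K]_n, x != 0 -> 0 < bilin P x x) ->
  exists2 a : K, 0 < a & forall x : 'cV[K]_n, a * `|x| ^+ 2 <= bilin P x x.
Proof.
move=> P_gt0; pose S : set 'rV[K]_n := [set v | `|v| = 1]%classic.
have scaleS (x : 'cV[K]_n) : x != 0 -> (S (`|x|^-1 *: x)^T)%classic.
  move=> x0; rewrite /S /= norm_trmx normrZ normfV normr_id mulVf//.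
  by rewrite normr_eq0.
have [[v0 Sv0]|S0] := pselect (S !=set0)%classic; last first.
  (* An empty sphere means that every vector is 0, so any positive constant serves. *)
  exists 1 => // x; have [->|x0] := eqVneq x 0.
    by rewrite normr0 expr0n mulr0 bilin0r.
  by case: S0; exists (`|x|^-1 *: x)^T; exact: scaleS.
have cS : compact S.
  apply: bounded_closed_compact.
    by exists 1; split => // r r1 v /= ->; exact: ltW.
  rewrite (_ : S = (fun v => `|v|) @^-1` [set 1])%classic//.
  by apply: preimage_closed => // v _; exact: norm_continuous.
have trmx_continuous : continuous (fun v : 'rV[K]_n => v^T).
  move=> v A [B vB BA]; exists (fun i j => B j i) => [i j|w wB].
    by have := vB j i; rewrite mxE.
  by apply: BA => i j; rewrite mxE; exact: wB.
have bilin_continuous : continuous (fun v : 'rV[K]_n => bilin P v^T v^T).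
  by move=> v; apply: cvg_bilin (trmx_continuous v) (trmx_continuous v).
have [|v Sv vmin] := @compact_EVT_min _ _
    (fun v : 'rV[K]_n => bilin P v^T v^T) S (ex_intro _ v0 Sv0) cS.
  exact: continuous_subspaceT bilin_continuous.
exists (bilin P v^T v^T) => [|x].
  apply: P_gt0; move: Sv; rewrite inE /S /= -norm_trmx => v1.
  by rewrite -normr_eq0 v1 oner_eq0.
have [->|x0] := eqVneq x 0.
  by rewrite normr0 expr0n mulr0 bilin0r.
have := vmin _ (mem_set (scaleS _ x0)).
rewrite trmxK bilinZr bilinZl mulrA -invfM -expr2 mulrC.
by rewrite ler_pdivlMr// exprn_gt0 ?normr_gt0.
Qed.

(** * Differentiation of bilinear forms *)

Lemma is_derive_mxP {K : realType} m p (f : K -> 'M[K]_(m, p)) (t : K) df :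
  is_derive t 1 f df <-> forall i j, is_derive t 1 (fun s => f s i j) (df i j).
Proof.
split=> [[fd <-] i j|fd].
  apply: DeriveDef; first exact: (derivable_mxP _ _ _).1.
  by rewrite derive_mx// mxE.
have f_derivable : derivable f t 1.
  by apply/derivable_mxP => i j; apply: ex_derive.
apply: DeriveDef => //; rewrite derive_mx//; apply/matrixP => i j.
by rewrite mxE derive_val.
Qed.

Lemma is_derive_bilin {K : realType} {n : nat} (P : 'M[K]_n)
    (f g : K -> 'cV[K]_n) (t : K) df dg :
  is_derive t 1 f df -> is_derive t 1 g dg ->
  is_derive t 1 (fun s => bilin P (f s) (g s))
    (bilin P df (g t) + bilin P (f t) dg).
Proof.
move=> /is_derive_mxP fd /is_derive_mxP gd.
(* As a sum of scaled products of coordinate functions, the form is differentiated by the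
   [is_derive] instances. *)
rewrite (_ : (fun s => _) = \sum_j \sum_i
    (P i j \*: ((fun s => f s i 0) * (fun s => g s j 0)))); last first.
  apply/funext => s; rewrite bilinE fct_sumE; apply: eq_bigr => j _.
  by rewrite fct_sumE; apply: eq_bigr => i _ /=; rewrite mulrAC mulrC.
apply: is_derive_eq.
rewrite !bilinE -big_split /=; apply: eq_bigr => j _.
rewrite -big_split /=; apply: eq_bigr => i _.
by rewrite /GRing.scale /=; ring.
Qed.

(** * Lyapunov's direct method *)

Section LinearFlow.
Local Open Scope classical_set_scope.
Local Open Scope ring_scope.
Context {K : realType} {n : nat}.
Implicit Types (M P : 'M[K]_n) (x y : K -> 'cV[K]_n).

Definition half_line_solution M x :=
  ode_solution (fun _ z => M *m z) `[0, +oo[ x.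

(** The left side is what the product rule gives for the derivative of [bilin P] along two solutions
    of x' = M x. *)
Lemma bilin_lyapunov M P (u v : 'cV[K]_n) :
  bilin P (M *m u) v + bilin P u (M *m v) = bilin (M^T *m P + P *m M) u v.
Proof. by rewrite /bilin trmx_mul mulmxDr mulmxDl !mulmxA [RHS]mxE. Qed.

Lemma is_derive_bilin_solution M P x y (t : K) :
  half_line_solution M x -> half_line_solution M y -> 0 < t ->
  is_derive t 1 (fun s => bilin P (x s) (y s))
    (bilin (M^T *m P + P *m M) (x t) (y t)).
Proof.
move=> [_ xd] [_ yd] t0; rewrite -bilin_lyapunov.
by apply: is_derive_bilin; [apply: xd|apply: yd];
  rewrite interior_itv_bndy /= in_itv /= t0.
Qed.

Lemma continuous_bilin_solution M P x y :
  half_line_solution M x -> half_line_solution M y ->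
  {within `[0, +oo[, continuous (fun s => bilin P (x s) (y s))}.
Proof. by move=> [xc _] [yc _] t; apply: cvg_bilin; [exact: xc|exact: yc]. Qed.

(** With a |x|^2 <= V <= b |x|^2 and V' <= - w |x|^2 one gets V' <= - (w / b) V. So V exp((w / b) t)
    is nonincreasing, which gives c = w / b and k = b / a. *)
Lemma lyapunov_decay M P :
  (forall u : 'cV[K]_n, u != 0 -> 0 < bilin P u u) ->
  (forall u : 'cV[K]_n, u != 0 -> bilin (M^T *m P + P *m M) u u < 0) ->
  exists k c : K, [/\ 0 < k, 0 < c & forall x, half_line_solution M x ->
    forall t, 0 <= t -> `|x t| ^+ 2 * expR (c * t) <= k * `|x 0| ^+ 2].
Proof.
move=> P_gt0 W_lt0; set W := M^T *m P + P *m M in W_lt0.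
have [a a0 Pa] := bilin_ge_norm _ P_gt0.
have [b b0 Pb] := bilin_le_norm P.
have [w w0 Ww] : exists2 w : K, 0 < w &
    forall u : 'cV[K]_n, w * `|u| ^+ 2 <= - bilin W u u.
  have [|w w0 Ww] := bilin_ge_norm (- W).
    by move=> u u0; rewrite bilinN oppr_gt0 W_lt0.
  by exists w => // u; rewrite -bilinN.
exists (b / a), (w / b); split; rewrite ?divr_gt0// => x xs t t0.
pose V s := bilin P (x s) (x s).
have exp_d (s : K) : is_derive s 1 (fun s => expR (w / b * s))
    (w / b * expR (w / b * s)).
  by apply: is_derive_eq; rewrite /GRing.scale /=; ring.
have g_d (s : K) (s0 : 0 < s) : is_derive s 1 (fun s => V s * expR (w / b * s))
    ((w / b * V s + bilin W (x s) (x s)) * expR (w / b * s)).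
  have Vd := is_derive_bilin_solution M P x x s xs xs s0.
  by apply: is_derive_eq; rewrite /GRing.scale /= /V /W; ring.
have : V t * expR (w / b * t) <= V 0 * expR (w / b * 0).
  apply: (@ler0_derive1_nincry _ (fun s => V s * expR (w / b * s)) 0) => //.
  - by move=> s; rewrite in_itv /= andbT => /g_d ?; exact: ex_derive.
  - move=> s; rewrite in_itv /= andbT => /g_d ?; rewrite derive1E derive_val.
    rewrite mulr_le0_ge0 ?expR_ge0//.
    have := Ww (x s); have := Pb (x s); rewrite -/(V s) => Vb Wb.
    (* The upper bound [Vb] gives (w / b) V <= w |x|^2, and [Wb] makes the remaining sum
       nonpositive. *)
    apply: (@le_trans _ _ (w * `|x s| ^+ 2 + bilin W (x s) (x s))); last by lra.
    by rewrite lerD2r mulrAC ler_pdivrMr// -mulrA ler_pM2l// mulrC.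
  - move=> s; apply: cvgM; first exact: (continuous_bilin_solution M P _ _ xs xs s).
    apply: continuous_subspaceT => r; apply: differentiable_continuous.
    by apply/derivable1_diffP; apply: ex_derive.
rewrite mulr0 expR0 mulr1 => Vt.
rewrite [leRHS]mulrAC ler_pdivlMr// [leLHS]mulrC mulrA.
apply: le_trans (Pb _); apply: le_trans Vt.
by rewrite ler_wpM2r ?expR_ge0.
Qed.

Theorem lyapunov_stable M P : posdefmx P -> negdefmx (M^T *m P + P *m M) ->
  asymptotically_stable M.
Proof.
move=> [_ P_gt0] [_ W_lt0].
have [k [c [k0 c0 decay]]] := lyapunov_decay M P P_gt0 W_lt0.
split=> [e e0|x xs].
  (* Since k <= (1 + k)^2, the decay bound gives |x t| <= (1 + k) |x 0|. *)
  exists (e / (1 + k)) => [|x xs xd t t0]; first by rewrite divr_gt0// addr_gt0.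
  have xt : `|x t| ^+ 2 <= k * `|x 0| ^+ 2.
    apply: le_trans (decay x xs t t0).
    by rewrite ler_peMr ?sqr_ge0// -expR0 ler_expR mulr_ge0// ltW.
  rewrite -(@ltr_pXn2r _ 2) ?nnegrE ?(ltW e0)//; apply: le_lt_trans xt _.
  move: xd; rewrite ltr_pdivlMr ?addr_gt0// => xd.
  apply: (@le_lt_trans _ _ ((`|x 0| * (1 + k)) ^+ 2)).
    rewrite exprMn mulrC ler_wpM2l ?sqr_ge0//; nra.
  by rewrite ltr_pXn2r ?nnegrE ?mulr_ge0 ?addr_ge0// ltW.
apply/cvgr0Pnorm_lt => e e0; near=> t.
have t0 : 0 <= t by near: t; exact: nbhs_pinfty_ge.
rewrite -(@ltr_pXn2r _ 2) ?nnegrE ?(ltW e0)// -(ltr_pM2r (expR_gt0 (c * t))).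
apply: le_lt_trans (decay x xs t t0) _.
rewrite [ltRHS]mulrC -ltr_pdivrMr ?exprn_gt0//.
(* As exp(c t) >= 1 + c t, it suffices that t exceeds k |x 0|^2 / (e^2 c). *)
apply: lt_le_trans (expR_ge1Dx (c * t)); rewrite ltr_wpDl// [ltRHS]mulrC -ltr_pdivrMr//.
by near: t; apply: nbhs_pinfty_gt; rewrite ?num_real.
Unshelve. all: by end_near. Qed.

End LinearFlow.

(** * Exponential generating functions and the linear flow *)

Section ExponentialSeries.
Context {K : realType}.
Local Open Scope classical_set_scope.
Local Open Scope ring_scope.

Definition geometric_growth (u : nat -> K) :=
  exists C r : K, [/\ 0 <= C, 0 <= r & forall k, `|u k| <= C * r ^+ k].

(** Coefficients of the exponential generating function of [u]; differentiating that function shifts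
    [u]. *)
Definition egf (u : nat -> K) (k : nat) : K := u k / k`!%:R.

Lemma geometric_growth_shift u :
  geometric_growth u -> geometric_growth (fun k => u k.+1).
Proof.
move=> [C [r [C0 r0 ule]]]; exists (C * r), r; split; rewrite ?mulr_ge0// => k.
by rewrite -mulrA -exprS.
Qed.

(** The absolute values of the terms are dominated by those of the series C exp(r |z|). *)
Lemma is_cvg_egf u z : geometric_growth u -> cvgn (pseries (egf u) z).
Proof.
move=> [C [r [C0 r0 ule]]]; apply: normed_cvg.
apply: (@series_le_cvg _ _ (C *: exp_coeff (r * `|z|))) => [k|k|k|].
- exact: normr_ge0.
- by rewrite mulr_ge0// exp_coeff_ge0// mulr_ge0.
- rewrite /= /egf !normrM normfV normr_nat normrX mulrAC.
  rewrite [leRHS](_ : _ = C * r ^+ k * `|z| ^+ k / k`!%:R); last first.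
    by rewrite -!mulrA [r ^+ k * _]mulrA -exprMn.
  by rewrite ler_wpM2r ?invr_ge0// ler_wpM2r ?exprn_ge0.
- exact: is_cvg_seriesZ (is_cvg_series_exp_coeff _).
Qed.

Lemma pseries_diffs_egf u : pseries_diffs (egf u) = egf (fun k => u k.+1).
Proof.
apply/funext => k; rewrite /pseries_diffs /egf factS natrM invfM mulrCA.
by rewrite mulVKf.
Qed.

Lemma is_derive_egf u (z : K) : geometric_growth u ->
  is_derive z 1 (fun s => limn (pseries (egf u) s))
    (limn (pseries (egf (fun k => u k.+1)) z)).
Proof.
(* Termwise differentiation at [z] asks for convergence of the series and its first two formal
   derivatives at a point of larger modulus, here |z| + 1. *)
move=> ug; rewrite -pseries_diffs_egf; apply: (@pseries_snd_diffs _ _ (`|z| + 1)).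
- exact: is_cvg_egf.
- by rewrite pseries_diffs_egf; exact/is_cvg_egf/geometric_growth_shift.
- rewrite !pseries_diffs_egf.
  exact: (is_cvg_egf _ _ (geometric_growth_shift _ (geometric_growth_shift _ ug))).
- by rewrite [ltRHS]ger0_norm// ltrDl.
Qed.

Lemma lim_egf0 u : limn (pseries (egf u) 0) = u 0%N.
Proof.
(* The partial sum of index 0 is empty; from index 1 on all equal [u 0]. *)
apply: cvg_lim => //; apply: cvg_near_cst; exists 1%N => // -[//|k] _.
rewrite /pseries /series /= big_nat_recl//= big1 => [|i _].
  by rewrite addr0 /egf expr0 mulr1 fact0 divr1.
by rewrite expr0n mulr0.
Qed.

End ExponentialSeries.

(** The solution is exp(t M) x0, built by coordinates: the i-th one is the generating function of
    the i-th entries of M^k x0. *)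
Lemma linear_flow_exists {K : realType} {n : nat} (M : 'M[K]_n) (x0 : 'cV[K]_n) :
  exists2 x, half_line_solution M x & x 0 = x0.
Proof.
pose u (i : 'I_n) k : K := iter k (mulmx M) x0 i 0.
(* This [r] bounds the operator norm of [M] for the maximum norm, so M^k x0 grows at most like
   r^k. *)
pose r := \sum_i \sum_j `|M i j|.
have r0 : 0 <= r by rewrite sumr_ge0// => i _; rewrite sumr_ge0.
have Mr (v : 'cV[K]_n) : `|M *m v| <= r * `|v|.
  rewrite [leLHS]/Num.norm /= mx_normrE bigmax_le ?mulr_ge0// => -[i j] _.
  rewrite ord1 mxE; apply: le_trans (ler_norm_sum _ _ _) _ => /=.
  apply: (@le_trans _ _ ((\sum_j `|M i j|) * `|v|)).
    rewrite mulr_suml ler_sum// => k _.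
    by rewrite normrM ler_wpM2l// mx_entry_le_norm.
  rewrite ler_wpM2r// [leRHS](bigD1 i)//= lerDl sumr_ge0// => k _.
  by rewrite sumr_ge0.
have ug i : geometric_growth (u i).
  exists `|x0|, r; split => // k; apply: le_trans (mx_entry_le_norm _ _ _ _ _) _.
  elim: k => [|k IHk]; first by rewrite mulr1.
  by rewrite iterS (le_trans (Mr _))// exprS mulrCA ler_wpM2l.
pose x (t : K) : 'cV[K]_n := \col_i limn (pseries (egf (u i)) t).
have xd (t : K) : is_derive t 1 x (M *m x t).
  apply/is_derive_mxP => i j; rewrite ord1.
  rewrite (_ : (fun s => _) = fun s => limn (pseries (egf (u i)) s)); last first.
    by apply/funext => s; rewrite mxE.
  apply: is_derive_eq (is_derive_egf _ _ (ug i)) _.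
  rewrite mxE; apply: cvg_lim => //.
  under eq_bigr do rewrite mxE.
  (* Because M^(k+1) x0 = M (M^k x0), each partial sum of the shifted series is a row of [M] applied
     to the partial sums of the coordinates. *)
  rewrite (_ : pseries _ t =
      fun k => \sum_j M i j * pseries (egf (u j)) t k); last first.
    apply/funext => k; rewrite /pseries /series /=.
    under [RHS]eq_bigr do rewrite mulr_sumr.
    rewrite exchange_big /=; apply: eq_bigr => l _.
    rewrite /egf /u iterS mxE !mulr_suml; apply: eq_bigr => q _.
    by rewrite !mulrA.
  apply: cvg_big => [|q _]; first exact: add_continuous.
  by apply: cvgM; [exact: cvg_cst|exact: is_cvg_egf].
exists x; last by apply/matrixP => i j; rewrite ord1 mxE lim_egf0.
split=> [|t _]; last exact: xd.
apply: continuous_subspaceT => t; apply: differentiable_continuous.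
by apply/derivable1_diffP; apply: ex_derive.
Qed.

(** * The converse Lyapunov theorem *)

Section ConverseLyapunov.
Context {K : realType} {n : nat} (M : 'M[K]_n).
Context (M_stable : asymptotically_stable M).
Local Open Scope classical_set_scope.
Local Open Scope ring_scope.

(* [bilin P (x t) (y t)] is nonincreasing and tends to 0 as [t] grows. *)
Lemma bilin_stable_ge0 (P : 'M[K]_n) (x y : K -> 'cV[K]_n) :
  half_line_solution M x -> half_line_solution M y ->
  (forall t, 0 < t -> bilin (M^T *m P + P *m M) (x t) (y t) <= 0) ->
  0 <= bilin P (x 0) (y 0).
Proof.
move=> xs ys W_le0; pose V t := bilin P (x t) (y t).
have Vd (t : K) (t0 : 0 < t) := is_derive_bilin_solution M P x y t xs ys t0.
have VD s t : 0 <= s -> s <= t -> V t <= V s.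
  apply: ler0_derive1_nincry.
  - by move=> r; rewrite in_itv /= andbT => /Vd ?; exact: ex_derive.
  - move=> r; rewrite in_itv /= andbT => r0; have ? := Vd r r0.
    by rewrite derive1E derive_val W_le0.
  - exact: continuous_bilin_solution xs ys.
have : V t @[t --> +oo] --> bilin P 0 0.
  by apply: cvg_bilin; [exact: M_stable.2 x xs|exact: M_stable.2 y ys].
rewrite bilin0r => /cvgr_to_le; apply; near=> t.
by apply: VD => //; near: t; exact: nbhs_pinfty_ge.
Unshelve. all: by end_near. Qed.

(** [bilin_stable_ge0] applies to both [P] and [- P], so the form vanishes at all initial states,
    which are arbitrary. *)
Lemma lyapunov_inj (P : 'M[K]_n) : M^T *m P + P *m M = 0 -> P = 0.
Proof.
move=> MP; apply: bilin0P => u v.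
have [x xs <-] := linear_flow_exists M u.
have [y ys <-] := linear_flow_exists M v.
have bilin_ge0 (Q : 'M[K]_n) :
    M^T *m Q + Q *m M = 0 -> 0 <= bilin Q (x 0) (y 0).
  move=> MQ; apply: bilin_stable_ge0 => // t _.
  by rewrite MQ /bilin mulmx0 mul0mx mxE.
apply/eqP; rewrite eq_le bilin_ge0// andbT.
have := bilin_ge0 (- P); rewrite mulmxN mulNmx -opprD MP oppr0 => /(_ erefl).
by rewrite bilinN oppr_ge0.
Qed.

(** An injective endomorphism of the finite-dimensional space of matrices is onto; [lin_mx L] is its
    matrix on vectorized matrices. *)
Lemma lyapunov_surj (Q : 'M[K]_n) : exists P, M^T *m P + P *m M = Q.
Proof.
pose L : {linear 'M[K]_n -> 'M[K]_n} := mulmx M^T \+ mulmxr M.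
have Lfree : row_free (lin_mx L).
  apply: inj_row_free => v; rewrite mul_rV_lin => /(canRL mxvecK).
  by rewrite linear0 => /lyapunov_inj/(canRL vec_mxK); rewrite linear0.
exists (vec_mx (mxvec Q *m invmx (lin_mx L))).
apply: (can_inj mxvecK); rewrite -[mxvec (_ + _)](mul_rV_lin L).
by rewrite mulmxKV// -row_free_unit.
Qed.

Theorem stable_lyapunov :
  exists P, posdefmx P /\ negdefmx (M^T *m P + P *m M).
Proof.
have [P MP] := lyapunov_surj (- 1%:M).
have Psym : P^T = P.
  have WT : M^T *m P^T + P^T *m M = (M^T *m P + P *m M)^T.
    by rewrite linearD /= !trmx_mul trmxK addrC.
  (* The right-hand side -1 is symmetric, so [P^T - P] lies in the kernel of the Lyapunov
     operator. *)
  apply/eqP; rewrite -subr_eq0; apply/eqP/lyapunov_inj.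
  rewrite mulmxBr mulmxBl addrACA -opprD WT MP.
  by rewrite linearN /= trmx1 subrr.
have WE (u : 'cV[K]_n) : bilin (M^T *m P + P *m M) u u = - bilin 1%:M u u.
  by rewrite MP bilinN.
have W_lt0 (u : 'cV[K]_n) : u != 0 -> bilin (M^T *m P + P *m M) u u < 0.
  by move=> /bilin1_gt0; rewrite WE oppr_lt0.
have P_ge0 (u : 'cV[K]_n) : 0 <= bilin P u u.
  have [x xs <-] := linear_flow_exists M u.
  apply: bilin_stable_ge0 => // t _.
  have [->|/W_lt0/ltW//] := eqVneq (x t) 0.
  by rewrite bilin0r.
exists P; split; last by split; [rewrite MP linearN /= trmx1|exact: W_lt0].
split=> // u u0; rewrite -/(bilin P u u) lt0r P_ge0 andbT.
apply/negP => /eqP Puu.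
(* If [bilin P u u = 0], the form is affine on the line [M u + s u], and a
   nonnegative affine function has slope [b + b = 0]. *)
have := W_lt0 u u0; rewrite -bilin_lyapunov.
set b := bilin P u (M *m u).
have bC : bilin P (M *m u) u = b by rewrite -bilin_tr Psym.
rewrite bC => b_lt0.
(* With this [s] the form takes the value -1 at [M *m u + s *: u]. *)
pose s := - (bilin P (M *m u) (M *m u) + 1) / (b + b).
have := P_ge0 (M *m u + s *: u).
rewrite !(bilinDl, bilinDr, bilinZl, bilinZr) Puu !mulr0 addr0.
rewrite bC -/b -addrA -mulrDr /s mulfVK ?lt_eqF//; lra.
Qed.

End ConverseLyapunov.

(** * Static output feedback *)

Theorem mainTheorem1 (K : realType) (n m p : nat)
    (A : 'M[K]_n) (B : 'M[K]_(n, m)) (C : 'M[K]_(p, n))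
    (hAB : controllable A B) (hAC : observable A C)
    (Q : 'M[K]_n) (R : 'M[K]_m)
    (hQ : possemidefmx Q) (hR : posdefmx R)
    (hAQ : observable A (sqrtmx Q)) :
  (forall P : 'M[K]_n,
     posdefmx P ->
     - (A^T *m P) - P *m A + P *m B *m invmx R *m B^T *m P = Q ->
     forall F : 'M[K]_(m, p),
       negdefmx ((A + B *m F *m C)^T *m P + P *m (A + B *m F *m C)) ->
       stabilizing_output_feedback A B C F) /\
  (static_output_feedback_stabilizable A B C ->
     exists (F : 'M[K]_(m, p)) (P : 'M[K]_n),
       posdefmx P /\
       negdefmx ((A + B *m F *m C)^T *m P + P *m (A + B *m F *m C))).
Proof.
split=> [P P_pos _ F|[F F_stable]]; first exact: lyapunov_stable P_pos.
by exists F; exact: stable_lyapunov.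
Qed.
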